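(* Let $d\ge 2$, $t\ge 2$, $n\ge 5$ be integers with $n\ge 2t$. Define $S\subseteq\mathcal A_d^n$ as the union of $$\{x\in\mathcal A_d^n : \text{for some } m\in\mathcal A_d \text{ and some integer } 1\le \ell\le t,\ x^{(t,m)}(t+1-\ell:n-1)\text{ is } \ell\text{-periodic, but } x^{(t,m)}(t+1-\ell:n-1)\oplus (x_n+m)\text{ is not } \ell\text{-periodic}\}$$ and $$\{x\in\mathcal A_d^n : x_t\ne x_n \text{ and } x^{(t,m)}(t+1-\ell:n-1)\text{ is not } \ell\text{-periodic for any } m\in\mathcal A_d \text{ and any integer } 1\le\ell\le t\}.$$ Then $S$ is a $t$-identifying code of $\vec{\mathcal B}(d,n)$ of size $d^{n-1}(d-1)$, and no $t$-identifying code of $\vec{\mathcal B}(d,n)$ has fewer vertices.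
   Context: $\mathcal A_d=\{0,1,\dots,d-1\}$; $\mathcal A_d^n$ is the set of strings $x=x_1\cdots x_n$ over $\mathcal A_d$; letter sums such as $x_n+m$ are taken modulo $d$. The directed de Bruijn graph $\vec{\mathcal B}(d,n)$ has vertex set $\mathcal A_d^n$ and an arc from $x_1\cdots x_n$ to $y_1\cdots y_n$ iff $x_2\cdots x_n=y_1\cdots y_{n-1}$. $\vec d(u,v)$ is the length of a shortest directed walk from $u$ to $v$; $B_t^-(v)=\{u:\vec d(u,v)\le t\}$; for $S\subseteq V$, $\mathrm{ID}_S(v)=B_t^-(v)\cap S$; a $t$-identifying code is a set $S$ with $\mathrm{ID}_S(v)\ne\emptyset$ for all $v$ and $\mathrm{ID}_S(u)\ne\mathrm{ID}_S(v)$ for all $u\ne v$. String notation: $x(a:b)=x_ax_{a+1}\cdots x_b$; $\oplus$ denotes concatenation (a single letter is a string of length 1). For $w\in\mathcal A_d^n$, a position $t$ and $m\in\mathcal A_d$, $w^{(t,m)}$ is the string obtained from $w$ by replacing $w_t$ by $(w_t+m)\bmod d$ and leaving all other letters unchanged. A string $w$ of length $L$ has period length $\ell$ (a positive integer) if $L\ge 2\ell$ and $w_i=w_{i+\ell}$ for all $1\le i\le L-\ell$; $w$ is $\ell$-periodic if it has period length $\ell$ and has no period length $k$ with $k<\ell$. *)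

(* Defs.v *)
From mathcomp Require Import all_boot all_order all_algebra.

Set Implicit Arguments.
Unset Strict Implicit.
Unset Printing Implicit Defensive.

Section Digraph.
Variables (V : finType) (e : rel V).

Definition has_walk (k : nat) (u v : V) : bool :=
  [exists p : k.-tuple V, path e u p && (last u p == v)].

(* The distance is a relation because it is undefined when v is not reachable
   from u. *)
Definition is_dist (u v : V) (k : nat) : bool :=
  has_walk k u v && [forall j : 'I_k, ~~ has_walk j u v].

Definition in_ball (t : nat) (v : V) : {set V} :=
  [set u | [exists k : 'I_t.+1, is_dist u v k]].

Definition ID (t : nat) (S : {set V}) (v : V) : {set V} := in_ball t v :&: S.

Definition identifying_code (t : nat) (S : {set V}) : Prop :=
  (forall v, ID t S v <> set0) /\
  (forall u v, u <> v -> ID t S u <> ID t S v).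

End Digraph.

(* Positions in strings are counted from 1; the functions below are only
   meaningful at positions i with 1 <= i <= size w. *)

Definition substr (T : Type) (w : seq T) (a b : nat) : seq T :=
  drop a.-1 (take b w).

Definition has_period (T : eqType) (w : seq T) (l : nat) : bool :=
  [&& 0 < l, 2 * l <= size w &
      [forall i : 'I_(size w - l), onth w i == onth w (i + l)]].

Definition periodic (T : eqType) (l : nat) (w : seq T) : bool :=
  has_period w l && [forall k : 'I_l, ~~ has_period w k].

(* The alphabet {0, ..., d-1} with addition modulo d is 'Z_d, for d >= 2. *)

Definition letter (d : nat) (w : seq 'Z_d) (i : nat) : 'Z_d :=
  nth 0%R w i.-1.

(* The string written w^(i,m) on paper. *)
Definition shift_letter (d : nat) (w : seq 'Z_d) (i : nat) (m : 'Z_d) :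
    seq 'Z_d :=
  set_nth 0%R w i.-1 (letter w i + m)%R.

Definition deBruijn (d n : nat) : rel (n.-tuple 'Z_d) :=
  fun x y => substr x 2 n == substr y 1 (n - 1).

(* x^(t,m)(t+1-l : n-1) *)
Definition window (d n t : nat) (x : n.-tuple 'Z_d) (m : 'Z_d) (l : nat) :
    seq 'Z_d :=
  substr (shift_letter x t m) (t + 1 - l) (n - 1).

Definition code_periodic (d n t : nat) : {set n.-tuple 'Z_d} :=
  [set x : n.-tuple 'Z_d | [exists m : 'Z_d, exists l : 'I_t.+1,
     [&& 1 <= l, periodic l (window t x m l) &
         ~~ periodic l (window t x m l ++ [:: (letter x n + m)%R])]]].

Definition code_aperiodic (d n t : nat) : {set n.-tuple 'Z_d} :=
  [set x : n.-tuple 'Z_d | (letter x t != letter x n) &&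
     [forall m : 'Z_d, forall l : 'I_t.+1,
        (1 <= l) ==> ~~ periodic l (window t x m l)]].

Definition code (d n t : nat) : {set n.-tuple 'Z_d} :=
  code_periodic d n t :|: code_aperiodic d n t.

(* Main.v *)
Require Import Defs.
From mathcomp Require Import all_boot all_order all_algebra.
From mathcomp Require Import zify.

Set Implicit Arguments.
Unset Strict Implicit.
Unset Printing Implicit Defensive.

Import GRing.Theory.

(** Membership of x in the code only depends on the difference x_n - x_t and on
the letters at the other positions: x is a codeword iff x_n - x_t differs from
an offset computed from those other letters. This offset is well defined by a
Fine-Wilf type argument ([two_periods]): all admissible periods of the window
predict the same letters at t and n. Hence every word of length n-1 has exactly
one extension by a last letter outside the code, which gives the size; and any
t-identifying code misses at most one such extension, which gives optimality.

To separate u from v, let D be the first position where they differ. If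
D > n - t, prepend to u(1:D) and v(1:D) letters distinct from v_1; one of the
two words is a codeword, and it lies in only one of the two balls, because a word
that is periodic from around t up to n is never a codeword ([period_offset]).
If D <= n - t, words w u(1:n-t) with the first t-1 letters of w distinct from
v_1 force u(1:n-t) = v(2:n-t+1), and symmetrically; then u and v begin with
baba... and abab..., and b...b c u(1:n-t) with c <> a is a codeword separating
them. *)

(** * Words with two periods *)

Lemma two_periods (T : Type) (z : nat -> T) (p q : nat) :
    0 < p -> 0 < q ->
    (forall i, 0 < i < q -> z i = z (i + p)) ->
    (forall i, 0 < i < p -> z i = z (i + q)) ->
  z p = z q.
Proof.
have [N] := ubnP (p + q); elim: N p q => // N IH p q leN p0 q0 zp zq.
have IHlt p' q' : p' < q' -> p' + q' <= N -> 0 < p' ->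
    (forall i, 0 < i < q' -> z i = z (i + p')) ->
    (forall i, 0 < i < p' -> z i = z (i + q')) -> z p' = z q'.
  move=> lt le p0' zp' zq'.
  (* One step of Euclid's algorithm: the pair [p'], [q'] is replaced by [p'], [q' - p']. *)
  have -> : z p' = z (q' - p').
    apply: IH => [|//||i hi|i hi]; try lia.
      by apply: zp'; lia.
    by rewrite zq' // [RHS]zp'; [congr z|]; lia.
  by rewrite zp'; [congr z|]; lia.
have [lt|lt|->//] := ltngtP p q; first by apply: IHlt => //; lia.
by apply/esym/IHlt => //; lia.
Qed.

Lemma has_period_mkseq (T : eqType) (g : nat -> T) N k :
  reflect [/\ 0 < k, 2 * k <= N & forall i, i + k < N -> g i = g (i + k)]
          (has_period (mkseq g N) k).
Proof.
rewrite /has_period size_mkseq.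
have onthg i : i < N -> onth (mkseq g N) i = Some (g i).
  by move=> hi; rewrite onthE (nth_map (g 0)) ?size_mkseq ?nth_mkseq.
apply: (iffP and3P) => [[k0 kN /forallP H]|[k0 kN H]]; split=> //.
  move=> i hi; have hi' : i < N - k by lia.
  by have /eqP := H (Ordinal hi'); rewrite /= !onthg; [case|lia..].
apply/forallP => -[i hi] /=.
by rewrite !onthg; [rewrite -H //; lia|lia..].
Qed.

(** * The letter difference forced by a period *)

Section Offset.
Variables (V : zmodType) (n t : nat).
Implicit Types X Y : nat -> V.

(* The conditions for X(t+1-l : n-1) to have period l that do not involve the
   letter X t. *)
Definition weak_period X l :=
  [&& 0 < l, l <= t, t + l < n &
      all (fun i => (t < i + l) && (i != t) ==> (X i == X (i + l)))
          (iota 0 (n - l))].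

Lemma weak_periodP X l :
  reflect [/\ 0 < l, l <= t, t + l < n &
             forall i, t < i + l -> i + l < n -> i != t -> X i = X (i + l)]
          (weak_period X l).
Proof.
apply: (iffP and4P) => [[h1 h2 h3 /allP H]|[h1 h2 h3 H]]; split=> //.
  move=> i hi hn ht; apply/eqP.
  have ii : i \in iota 0 (n - l) by rewrite mem_iota; lia.
  by have := H i ii; rewrite hi ht.
apply/allP=> i; rewrite mem_iota => hi; apply/implyP => /andP[h ht].
by apply/eqP/H => //; lia.
Qed.

Lemma eq_weak_period X Y l :
  (forall i, 0 < i < n -> i != t -> X i = Y i) ->
  weak_period X l = weak_period Y l.
Proof.
move=> XY; apply/weak_periodP/weak_periodP => -[h1 h2 h3 H]; split=> // i *.
  by rewrite -!XY; [apply: H|..]; lia.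
by rewrite !XY; [apply: H|..]; lia.
Qed.

(** [X (t + l)] and [X (n - l)] are the letters that period [l] predicts at [t] and [n]. Right of
    [t], going back [l] and forward [k] gives the second period [k - l] that [two_periods] needs. *)
Lemma weak_period_unique_lt X l k : l < k ->
    weak_period X l -> weak_period X k ->
  X (t + l) = X (t + k) /\ X (n - l) = X (n - k).
Proof.
move=> lk /weak_periodP[l0 lt ln El] /weak_periodP[k0 kt kn Ek].
have e1 : X (t + l) = X (t + k).
  have -> : X (t + l) = X (t + (k - l)).
    apply: (@two_periods _ (fun i => X (t + i))) => [//||i hi|i hi]; first lia.
      by rewrite El ?addnA //; lia.
    have -> : t + i = (t + i - l) + l by lia.
    rewrite -El; [rewrite Ek; [congr X|..]|..]; lia.
  by rewrite El; [congr X|..]; lia.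
(* Both [n - l] and [n - k] are reached from [n - k - l]; if that is the excluded position [t], the
   claim is the first equality again. *)
split=> //; have [e|ne] := eqVneq (n - k - l) t.
  have -> : n - l = t + k by lia.
  by have -> : n - k = t + l by lia.
have -> : n - k = (n - k - l) + l by lia.
by rewrite -El; [rewrite [RHS]Ek; [congr X|..]|..]; lia.
Qed.

Lemma weak_period_unique X l k :
    weak_period X l -> weak_period X k ->
  X (t + l) = X (t + k) /\ X (n - l) = X (n - k).
Proof.
have [lk|kl|-> //] := ltngtP l k; first exact: weak_period_unique_lt.
by move=> hl hk; have [-> ->] := weak_period_unique_lt kl hk hl.
Qed.

(** The value that [X n - X t] takes if a weak period holds at [t] and at [n] as well. The default 0
    matches the condition x_t <> x_n in the second part of the code. *)
Definition offset X : V :=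
  if [pick l : 'I_t.+1 | weak_period X l] is Some l
  then (X (n - l)%N - X (t + l)%N)%R else 0%R.

Lemma offsetE X l : weak_period X l -> offset X = (X (n - l)%N - X (t + l)%N)%R.
Proof.
move=> wl; rewrite /offset; case: pickP => [k wk|/= no].
  by have [-> ->] := weak_period_unique wk wl.
have /weak_periodP[_ lt _ _] := wl.
by have /= := no (Ordinal (lt : l < t.+1)); rewrite wl.
Qed.

Lemma offset0 X : (forall l, ~~ weak_period X l) -> offset X = 0%R.
Proof.
by move=> no; rewrite /offset; case: pickP => // k; rewrite (negPf (no k)).
Qed.

Lemma eq_offset X Y :
  (forall i, 0 < i < n -> i != t -> X i = Y i) -> offset X = offset Y.
Proof.
move=> XY; rewrite /offset.
under eq_pick => l do rewrite (eq_weak_period _ XY).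
case: pickP => // l /weak_periodP[l0 lt ln _].
by rewrite !XY //; lia.
Qed.

Lemma period_offset X p : 2 * t <= n -> 0 < p <= t ->
    (forall i, t < i + p -> i + p <= n -> X i = X (i + p)) ->
  (X n - X t)%R = offset X.
Proof.
move=> nt hp Xp; have [tp|tp] := ltnP (t + p) n.
  rewrite (@offsetE _ p); last first.
    by apply/weak_periodP; split; try lia; move=> i h1 h2 _; apply: Xp; lia.
  rewrite -(Xp t) ?(Xp (n - p)); try lia.
  by rewrite subnK //; lia.
(* Here [p = t] and [n = 2 * t], so [p] is too long to be a weak period, and the offset has to be
   shown to be 0. *)
have -> : X n = X t by rewrite (Xp t); [congr X|..]; lia.
rewrite subrr; case: (boolP [exists l : 'I_t.+1, weak_period X l]); last first.
  rewrite negb_exists => /forallP no; rewrite offset0 // => l.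
  apply/negP => wl; have /weak_periodP[_ lt _ _] := wl.
  by have := no (Ordinal (lt : l < t.+1)); rewrite wl.
case/existsP=> l wl; rewrite (offsetE wl).
have /weak_periodP[l0 lt ln El] := wl.
apply/esym/eqP; rewrite subr_eq0 eq_sym; apply/eqP.
(* Going back [l] and forward [p = t] gives the second period [t - l] right of [t]. *)
have -> : n - l = t + (t - l) by lia.
apply: (@two_periods _ (fun i => X (t + i))) => [//||i hi|i hi]; first lia.
  by rewrite El ?addnA //; lia.
have -> : t + i = (t + i - l) + l by lia.
by rewrite -El; [rewrite Xp; [congr X|..]|..]; lia.
Qed.

End Offset.

(** * The codeword criterion *)

Section Code.
Variables (d t n : nat).
Hypotheses (ht : 2 <= t) (hnt : 2 * t <= n).
Implicit Types x u v : n.-tuple 'Z_d.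

Local Notation V := 'Z_d.

(** The word x^(t,m) with x_n + m as last letter. Adding [m] at both positions keeps x_n - x_t. *)
Definition shift_both x (m : V) i : V :=
  (letter x i + (if (i == t) || (i == n) then m else 0))%R.

Lemma windowE x m l : 0 < l <= t ->
  window t x m l =
    mkseq (fun i => shift_both x m (t - l + i).+1) (n - 1 - (t - l)).
Proof.
move=> hl; rewrite /window /substr /shift_letter.
have sz : size (set_nth 0%R x t.-1 (letter x t + m)%R) = n.
  by rewrite size_set_nth size_tuple; lia.
have sz2 : size (drop (t + 1 - l).-1
    (take (n - 1) (set_nth 0%R x t.-1 (letter x t + m)%R))) = n - 1 - (t - l).
  by rewrite size_drop size_takel ?sz; lia.
apply: (@eq_from_nth _ 0%R); first by rewrite size_mkseq.
rewrite sz2 => i hi; rewrite nth_drop nth_take ?nth_mkseq //; last lia.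
rewrite nth_set_nth /= /shift_both.
have -> : (t + 1 - l).-1 + i = t - l + i by lia.
have -> : ((t - l + i).+1 == n) = false by lia.
rewrite orbF.
case: eqP => e; case: eqP => e'; try lia.
  by congr (letter x _ + _)%R; lia.
by rewrite addr0.
Qed.

Lemma window_catE x m l : 0 < l <= t ->
  window t x m l ++ [:: (letter x n + m)%R] =
    mkseq (fun i => shift_both x m (t - l + i).+1) (n - (t - l)).
Proof.
move=> hl; rewrite windowE // cats1.
have -> : n - (t - l) = (n - 1 - (t - l)).+1 by lia.
rewrite mkseqS; congr rcons; rewrite /shift_both.
have -> : (t - l + (n - 1 - (t - l))).+1 = n by lia.
by rewrite eqxx orbT.
Qed.

Lemma shift_bothE x m i : i != t -> i != n -> shift_both x m i = letter x i.
Proof. by rewrite /shift_both => /negPf-> /negPf->; rewrite addr0. Qed.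

Lemma shift_both_subr x m :
  (shift_both x m n - shift_both x m t = letter x n - letter x t)%R.
Proof.
by rewrite /shift_both !eqxx orbT /= opprD addrACA subrr addr0.
Qed.

Lemma periodic_window x m l : 0 < l <= t -> periodic l (window t x m l) ->
  weak_period n t (letter x) l /\ shift_both x m t = letter x (t + l).
Proof.
move=> hl /andP[/[!windowE] // /has_period_mkseq[_ lN H] _].
have {}H i : t < i + l -> i + l < n -> shift_both x m i = shift_both x m (i + l).
  move=> h1 h2; have := H (i - (t - l).+1).
  have -> : (t - l + (i - (t - l).+1)).+1 = i by lia.
  have -> : (t - l + (i - (t - l).+1 + l)).+1 = i + l by lia.
  by apply; lia.
split; last by rewrite H; [rewrite shift_bothE //; lia|lia..].
apply/weak_periodP; split; try lia.
by move=> i h1 h2 h3; have := H i h1 h2; rewrite !shift_bothE //; lia.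
Qed.

(** The appended letter adds a single equation, with the letter at [n - l]. No shorter period can
    appear, since it would already be a period of the window. *)
Lemma periodic_window_cat x m l : 0 < l <= t -> periodic l (window t x m l) ->
  periodic l (window t x m l ++ [:: (letter x n + m)%R]) =
    (letter x n - letter x t == offset n t (letter x))%R.
Proof.
move=> hl pl; have [wl et] := periodic_window hl pl.
have /weak_periodP[_ _ ln _] := wl.
rewrite (offsetE wl) -(shift_both_subr x m) et (can_eq (addrNK _)).
have -> : letter x (n - l) = shift_both x m (n - l).
  by rewrite shift_bothE //; lia.
move: pl; rewrite /periodic window_catE // windowE // => /andP[].
move=> /has_period_mkseq[_ lN H] /forallP min.
apply/andP/eqP => [[/has_period_mkseq[_ _ H'] _]|e].
  have := H' (n - l - (t - l).+1).
  have -> : (t - l + (n - l - (t - l).+1)).+1 = n - l by lia.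
  have -> : (t - l + (n - l - (t - l).+1 + l)).+1 = n by lia.
  by move=> ->//; lia.
split.
  apply/has_period_mkseq; split; try lia.
  move=> i hi; have [hi'|hi'] := ltnP (i + l) (n - 1 - (t - l)); first exact: H.
  have -> : (t - l + i).+1 = n - l by lia.
  by have -> : (t - l + (i + l)).+1 = n by lia.
apply/forallP => k; apply: contra (min k) => /has_period_mkseq[k0 kN Hk].
have kl := ltn_ord k.
apply/has_period_mkseq; split; try lia.
by move=> i hi; apply: Hk; lia.
Qed.

(** The least weak period [k] works, with the [m] that makes the letters at [t] and [t + k] equal: a
    shorter period of that window would be a smaller weak period. *)
Lemma weak_period_periodic x l : weak_period n t (letter x) l ->
  exists m, exists2 k, 0 < k <= t & periodic k (window t x m k).
Proof.
move=> wl; have ex : exists l, weak_period n t (letter x) l by exists l.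
case: (ex_minnP ex) => k wk min {l wl ex}.
have /weak_periodP[k0 kt kn Hk] := wk.
exists (letter x (t + k)%N - letter x t)%R, k; first by rewrite k0.
set m := (_ - _)%R.
have et : shift_both x m t = letter x (t + k).
  by rewrite /shift_both eqxx /= /m addrC subrK.
rewrite /periodic windowE ?k0 //; apply/andP; split.
  apply/has_period_mkseq; split; try lia.
  move=> i hi; rewrite [RHS]shift_bothE; try lia.
  have -> : (t - k + (i + k)).+1 = (t - k + i).+1 + k by lia.
  have [e|ne] := eqVneq (t - k + i).+1 t; first by rewrite e et.
  by rewrite shift_bothE; [apply: Hk|..]; lia.
apply/forallP => -[j /= jk]; apply/negP => /has_period_mkseq[j0 jN Hj].
suff /min : weak_period n t (letter x) j by lia.
apply/weak_periodP; split; try lia.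
move=> i h1 h2 h3; have := Hj (i - (t - k).+1).
have -> : (t - k + (i - (t - k).+1)).+1 = i by lia.
have -> : (t - k + (i - (t - k).+1 + j)).+1 = i + j by lia.
by rewrite !shift_bothE; [apply|..]; lia.
Qed.

(** If some window is periodic, only the first set matters and [periodic_window_cat] gives a test
    independent of [m] and [l]. Otherwise there is no weak period, the offset is 0 and x_t <> x_n
    remains. *)
Lemma in_codeE x :
  (x \in code d n t) = (letter x n - letter x t != offset n t (letter x))%R.
Proof.
rewrite !inE.
case: (boolP [exists m, exists l : 'I_t.+1, (1 <= l) && periodic l (window t x m l)]).
  move=> /existsP[m /existsP[l /andP[l0 pl]]].
  have lt : 0 < l <= t by rewrite l0 -ltnS ltn_ord.
  rewrite [X in _ || X](_ : _ = false) ?orbF; last first.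
    apply/negP => /andP[_ /forallP/(_ m)/forallP/(_ l)].
    by rewrite l0 pl.
  apply/existsP/idP => [[m' /existsP[k /and3P[k0 pk]]]|ne].
    by rewrite periodic_window_cat // k0 -ltnS ltn_ord.
  exists m; apply/existsP; exists l.
  by rewrite l0 pl periodic_window_cat.
move=> no; have no' m (l : 'I_t.+1) : ~~ ((1 <= l) && periodic l (window t x m l)).
  by apply: contra no => h; apply/existsP; exists m; apply/existsP; exists l.
case: existsP => [[m /existsP[l /and3P[l0 pl _]]]|_ /=].
  by have := no' m l; rewrite l0 pl.
rewrite offset0; last first.
  move=> l; apply/negP => /weak_period_periodic[m [k /andP[k0 kt] pk]].
  by have := no' m (Ordinal (kt : k < t.+1)); rewrite /= k0 pk.
rewrite subr_eq0 eq_sym -[RHS]andbT; congr (_ && _).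
by apply/forallP => m; apply/forallP => l; rewrite implybE -negb_and.
Qed.

(** * Words, walks and balls *)

Definition string_of (g : nat -> V) : n.-tuple V := [tuple g i.+1 | i < n].

Lemma letter_string_of g i : 0 < i <= n -> letter (string_of g) i = g i.
Proof.
clear ht hnt; move=> hi; have hi' : i.-1 < n by lia.
rewrite /letter /string_of -[i.-1]/(val (Ordinal hi')) -tnth_nth tnth_mktuple /=.
by congr g; lia.
Qed.

Lemma eq_letterP u v :
  (forall i, 0 < i <= n -> letter u i = letter v i) -> u = v.
Proof.
move=> uv; apply/val_inj/(@eq_from_nth _ 0%R); first by rewrite !size_tuple.
by move=> i; rewrite size_tuple => hi; apply: (uv i.+1).
Qed.

Lemma deBruijnP u v :
  reflect (forall i, 0 < i < n -> letter u i.+1 = letter v i) (deBruijn u v).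
Proof.
have n0 : 0 < n by lia.
have su : size (substr u 2 n) = n - 1.
  by rewrite /substr size_drop size_takel ?size_tuple; lia.
have sv : size (substr v 1 (n - 1)) = n - 1.
  by rewrite /substr size_drop size_takel ?size_tuple; lia.
have nu i : i < n - 1 -> nth 0%R (substr u 2 n) i = letter u i.+2.
  by move=> hi; rewrite /substr nth_drop nth_take //; lia.
have nv i : i < n - 1 -> nth 0%R (substr v 1 (n - 1)) i = letter v i.+1.
  by move=> hi; rewrite /substr nth_drop nth_take.
apply: (iffP eqP) => [e [//|i] hi|e].
  by rewrite -nu ?e ?nv //; lia.
apply: (@eq_from_nth _ 0%R); first by rewrite su sv.
by rewrite su => i hi; rewrite nu ?nv ?e //; lia.
Qed.

Lemma has_walkP k u v :
  reflect (forall i, 0 < i -> i + k <= n -> letter u (i + k) = letter v i)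
          (has_walk (@deBruijn d n) k u v).
Proof.
elim: k u => [|k IH] u.
  apply: (iffP existsP) => [[p /andP[]]|uv].
    rewrite (tuple0 p) /= => _ /eqP-> i _ _; by rewrite addn0.
  exists [tuple]; rewrite /=; apply/eqP/eq_letterP => i hi.
  by have := uv i; rewrite addn0; apply; lia.
apply: (iffP existsP) => [[p]|uv].
  case/tupleP: p => w p /= /andP[/andP[/deBruijnP uw wp] wv] i i0 ik.
  have /IH wvE : has_walk (@deBruijn d n) k w v.
    by apply/existsP; exists p; rewrite wp.
  by rewrite addnS uw ?wvE //; lia.
(* The letter appended first moves to position [n - k] during the other [k] steps; if [n <= k] it is
   lost and its value is irrelevant. *)
pose w := string_of (fun i => if i == n then letter v (n - k) else letter u i.+1).
have uw : deBruijn u w.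
  apply/deBruijnP => i hi; rewrite letter_string_of; last lia.
  by case: eqP => //; lia.
have /IH/existsP[p /andP[wp wv]] :
    forall i, 0 < i -> i + k <= n -> letter w (i + k) = letter v i.
  move=> i i0 ik; rewrite letter_string_of; last lia.
  case: eqP => e; first by congr letter; lia.
  by rewrite -uv ?addnS //; lia.
by exists [tuple of w :: p]; rewrite /= uw wp.
Qed.

Lemma in_ballP u v :
  reflect (exists2 k, k <= t &
             forall i, 0 < i -> i + k <= n -> letter u (i + k) = letter v i)
          (u \in in_ball (@deBruijn d n) t v).
Proof.
rewrite inE; apply: (iffP existsP) => [[k /andP[/has_walkP uv _]]|[k kt uv]].
  by exists k => //; rewrite -ltnS.
have ex : exists k, has_walk (@deBruijn d n) k u v by exists k; apply/has_walkP.
case: (ex_minnP ex) => j uvj min.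
have jt : j < t.+1 by rewrite ltnS (leq_trans _ kt) // min //; apply/has_walkP.
exists (Ordinal jt); rewrite /is_dist uvj /=.
by apply/forallP => i; apply/negP => /min; rewrite leqNgt ltn_ord.
Qed.

(** * Domination and separation *)

Local Notation ball := (in_ball (@deBruijn d n) t).

Lemma in_code_off x g :
    (forall i, 0 < i < n -> i != t -> letter x i = g i) ->
  (x \in code d n t) = (letter x n - letter x t != offset n t g)%R.
Proof.
by move=> xg; rewrite in_codeE (eq_offset xg).
Qed.

(** A walk of [t] steps forgets the first [t] letters, so the letter at [t] is free, and the offset
    does not depend on it. *)
Lemma code_dominating v : exists2 x, x \in code d n t & x \in ball v.
Proof.
pose g i := if i <= t then 0%R else letter v (i - t).
(* Chosen so that [g n - a] is the offset minus 1. *)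
pose a : V := (g n - offset n t g + 1)%R.
exists (string_of (fun i => if i == t then a else g i)).
  rewrite (@in_code_off _ g); last first.
    by move=> i hi /negPf it; rewrite letter_string_of ?it //; lia.
  rewrite !letter_string_of ?eqxx; try lia.
  have -> : (n == t) = false by lia.
  rewrite /a opprD opprB addrA addrCA subrr addr0 -subr_eq0 addrAC subrr.
  by rewrite add0r oppr_eq0 oner_neq0.
apply/in_ballP; exists t => // i i0 it.
rewrite letter_string_of /g; last lia.
have -> : (i + t == t) = false by lia.
have -> : (i + t <= t) = false by lia.
by rewrite addnK.
Qed.

(* A walk from x to v of length k > s would give x(t+1-p : n) the period
   p = k - s, which [period_offset] excludes for a codeword; one of length
   k < s would put v_1 among the first s letters of x. *)
Lemma near_codeword u v x D s :
    0 < D -> s + D = n -> s < t ->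
    (forall i, 0 < i < D -> letter u i = letter v i) ->
    letter u D <> letter v D ->
    (forall i, 0 < i <= D -> letter x (i + s) = letter u i) ->
    (forall i, 0 < i <= s -> letter x i <> letter v 1) ->
    x \in code d n t ->
  x \in ball u /\ x \notin ball v.
Proof.
move=> D0 sD st uv uvD xu xv; rewrite in_codeE => /eqP xS; split.
  apply/in_ballP; exists s; first lia.
  by move=> i i0 h; apply: xu; lia.
apply/negP => /in_ballP[k kt xk].
have [ks|ks|ks] := ltngtP k s.
- by apply: (xv k.+1); [lia|apply: (xk 1); lia].
- apply: xS; apply: (@period_offset _ _ _ _ (k - s)) => //; first lia.
  move=> i h1 h2; have -> : i + (k - s) = (i - s) + k by lia.
  rewrite xk; try lia.
  have {1}-> : i = (i - s) + s by lia.
  by rewrite xu ?uv //; lia.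
- by apply: uvD; rewrite -xu; [rewrite -ks xk //; lia|lia].
Qed.

Lemma separate_near u v D :
    n < D + t -> D <= n ->
    (forall i, 0 < i < D -> letter u i = letter v i) ->
    letter u D <> letter v D ->
  ID (@deBruijn d n) t (code d n t) u <> ID (@deBruijn d n) t (code d n t) v.
Proof.
move=> Dt Dn uv uvD eID; pose s := n - D.
have eB x : x \in code d n t -> (x \in ball u) = (x \in ball v).
  by move=> xS; move/setP/(_ x): eID; rewrite /ID !in_setI xS !andbT.
pose g i := if i <= s then (letter v 1 + 1)%R else letter u (i - s).
pose x a := string_of (fun i => if i == n then a else g i).
have xn a : letter (x a) n = a by rewrite letter_string_of ?eqxx //; lia.
have xg a i : 0 < i < n -> letter (x a) i = g i.
  by move=> hi; rewrite letter_string_of; [case: eqP => //; lia|lia].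
have ng i : i <= s -> g i <> letter v 1.
  move=> h; rewrite /g h => /eqP.
  by rewrite -subr_eq0 addrAC subrr add0r oner_eq0.
have gu i : 0 < i < D -> g (i + s) = letter u i.
  by move=> hi; rewrite /g; case: leqP => h; [lia|rewrite addnK].
have xS a : (x a \in code d n t) = (a - g t != offset n t g)%R.
  rewrite (@in_code_off _ g) ?xn; last by move=> i hi _; apply: xg.
  by rewrite xg //; lia.
have key u' v' : (forall i, 0 < i < D -> letter u' i = letter u i) ->
    (forall i, 0 < i < D -> letter v' i = letter u i) ->
    letter u' D <> letter v' D -> x (letter u' D) \in code d n t ->
  x (letter u' D) \in ball u' /\ x (letter u' D) \notin ball v'.
  move=> u'u v'u ne; apply: (@near_codeword _ _ _ D s) => //; try lia.
  - by move=> i hi; rewrite u'u ?v'u.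
  - move=> i hi; have [->|neD] := eqVneq i D.
      by have -> : D + s = n by lia.
    by rewrite xg ?gu ?u'u //; lia.
  - by move=> i hi; rewrite xg ?v'u ?uv; [apply: ng|..]; lia.
have [Su|nSu] := boolP (x (letter u D) \in code d n t).
  have [] := key u v (fun _ _ => erefl) (fun i hi => esym (uv i hi)) uvD Su.
  by rewrite eB // => ->.
(* The words [x a] share the letter at [t] and the offset, so only one [a] gives a non-codeword. *)
have Sv : x (letter v D) \in code d n t.
  move: nSu; rewrite !xS negbK => /eqP eu; apply/eqP => ev; apply: uvD.
  by apply: (@addIr _ (- g t)%R); rewrite eu ev.
have [] := key v u (fun i hi => esym (uv i hi)) (fun _ _ => erefl) (nesym uvD) Sv.
by rewrite eB // => ->.
Qed.

(** A walk from the codeword [x] built below to [v] must have length [t - 1]: length [t] would make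
    [u] and [v] agree at [D], and a shorter one would put v_1 among the first [t - 1] letters of
    [x]. *)
Lemma separate_far_shift u v D :
    0 < D <= n - t -> letter u D <> letter v D ->
    ID (@deBruijn d n) t (code d n t) u = ID (@deBruijn d n) t (code d n t) v ->
  forall i, 0 < i <= n - t -> letter u i = letter v i.+1.
Proof.
move=> hD uvD eID.
pose g i := if i <= t then (letter v 1 + 1)%R else letter u (i - t).
pose a : V := (g n - offset n t g + 1)%R.
pose x := string_of (fun i => if i == t then a else g i).
have xt : letter x t = a by rewrite letter_string_of ?eqxx //; lia.
have xg i : 0 < i <= n -> i != t -> letter x i = g i.
  by move=> hi /negPf it; rewrite letter_string_of ?it.
have xS : x \in code d n t.
  rewrite (@in_code_off _ g); last by move=> i hi it; rewrite xg //; lia.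
  rewrite xt xg; try lia.
  rewrite /a opprD opprB addrA addrCA subrr addr0 -subr_eq0 addrAC subrr.
  by rewrite add0r oppr_eq0 oner_neq0.
have xu i : 0 < i -> i + t <= n -> letter x (i + t) = letter u i.
  move=> i0 it; rewrite xg /g; try lia.
  by have -> : (i + t <= t) = false; [lia|rewrite addnK].
have : x \in ball v.
  have : x \in ball u by apply/in_ballP; exists t.
  by move/setP/(_ x): eID; rewrite /ID !in_setI xS !andbT => ->.
case/in_ballP => k kt xk.
have [e|ne] := eqVneq k t.
  by case: uvD; rewrite -xu; [rewrite -e xk //; lia|lia..].
have [e|ne'] := eqVneq k.+1 t.
  move=> i hi; rewrite -xu; [|lia..].
  by have -> : i + t = i.+1 + k; [lia|rewrite xk //; lia].
have := xk 1 isT; rewrite xg; [|lia..].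
rewrite /g; have -> : 1 + k <= t by lia.
move=> /(_ _)/eqP; rewrite -subr_eq0 addrAC subrr add0r oner_eq0.
by move=> h; have // : false by apply: h; lia.
Qed.

Lemma separate_far u v D : 5 <= n ->
    0 < D <= n - t -> letter u D <> letter v D ->
  ID (@deBruijn d n) t (code d n t) u <> ID (@deBruijn d n) t (code d n t) v.
Proof.
move=> hn hD uvD eID.
have uv := separate_far_shift hD uvD eID.
have vu := separate_far_shift hD (nesym uvD) (esym eID).
have per i : 0 < i -> i + 2 <= n - t -> letter u (i + 2) = letter u i.
  by move=> i0 h; rewrite addn2 -vu ?uv //; lia.
(* Agreement at position 1 would propagate along the two shifts up to [n - t]. *)
have ne1 : letter u 1 <> letter v 1.
  move=> e1; apply: uvD.
  have : forall i, 0 < i <= n - t -> letter u i = letter v i.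
    case=> // i; elim: i => [//|i IH] hi.
    by rewrite -vu; [rewrite -[RHS]uv; [rewrite IH //|]|]; lia.
  by apply.
pose g i := if i < t then letter u 1 else
            if i == t then (letter v 1 + 1)%R else letter u (i - t).
pose x := string_of g.
have xg i : 0 < i <= n -> letter x i = g i by exact: letter_string_of.
have gu i : 0 < i -> g (i + t) = letter u i.
  move=> i0; rewrite /g; case: ifP => h; first lia.
  by case: eqP => h'; [lia|rewrite addnK].
have gt : g t <> letter v 1.
  rewrite /g ltnn eqxx => /eqP.
  by rewrite -subr_eq0 addrAC subrr add0r oner_eq0.
(* The window meets the prefix only at [t - 1], where [g] is u_1 as at [t + 1]. The bound [5 <= n]
   gives [t + 2 < n] when [t = 2]. *)
have w2 : weak_period n t g 2.
  apply/weak_periodP; split; try lia.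
  move=> i h1 h2 h3; have [e|h] := ltnP i t.
    have -> : i + 2 = 1 + t by lia.
    by rewrite gu // /g e.
  have -> : i + 2 = (i - t + 2) + t by lia.
  have {1}-> : i = i - t + t by lia.
  by rewrite !gu ?per //; lia.
have xS : x \in code d n t.
  rewrite (@in_code_off _ g); last by move=> i hi _; rewrite xg //; lia.
  rewrite (offsetE w2) !xg; [|lia..].
  have -> : g n = g (n - 2).
    have -> : n = (n - t - 2 + 2) + t by lia.
    have -> : n - t - 2 + 2 + t - 2 = (n - t - 2) + t by lia.
    by rewrite !gu ?per //; lia.
  (* The codeword condition has become [g t] <> u_2, and u_2 = v_1. *)
  rewrite (inj_eq (addrI _)) eqr_opp addnC gu //.
  by apply/eqP => e; apply: gt; rewrite e vu //; lia.
have xu i : 0 < i -> i + t <= n -> letter x (i + t) = letter u i.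
  by move=> i0 it; rewrite xg ?gu //; lia.
have : x \in ball v.
  have : x \in ball u by apply/in_ballP; exists t.
  by move/setP/(_ x): eID; rewrite /ID !in_setI xS !andbT => ->.
case/in_ballP => k kt xk.
have [e|ne] := eqVneq k t.
  by case: uvD; rewrite -xu; [rewrite -e xk //; lia|lia..].
(* A walk of length [k < t] would make v_1 equal to [g t] or to u_1. *)
have := xk 1 isT; rewrite xg; [|lia..].
have [e|ne'] := eqVneq (1 + k) t; first by rewrite e => /(_ _)/gt; apply; lia.
by rewrite /g; case: ifP => h; [move=> /(_ _)/ne1; apply; lia|lia].
Qed.

Lemma identifying_code_code :
  5 <= n -> identifying_code (@deBruijn d n) t (code d n t).
Proof.
move=> hn; split=> [v|u v uv].
  have [x xS xv] := code_dominating v.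
  by move/setP/(_ x); rewrite /ID in_setI xS xv in_set0.
have ex : exists D, (0 < D <= n) && (letter u D != letter v D).
  have [/existsP[i ne]|] := boolP [exists i : 'I_n, letter u i.+1 != letter v i.+1].
    by exists i.+1; rewrite ltn_ord ne.
  rewrite negb_exists => /forallP no; case: uv; apply: eq_letterP => i hi.
  have hi' : i.-1 < n by lia.
  by have /negPn/eqP := no (Ordinal hi'); rewrite /= prednK //; lia.
case: (ex_minnP ex) => D /andP[hD /eqP ne] min.
have [Dt|Dt] := ltnP n (D + t); last by apply: (separate_far hn _ ne); lia.
apply: (separate_near Dt) ne => [|i hi]; first lia.
by apply/eqP; have := min i; case: eqP => //= _ /(_ _) h; lia.
Qed.

(** * Size and optimality *)

Definition prefix_of u : n.-1.-tuple V := [tuple letter u i.+1 | i < n.-1].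

Lemma eq_prefix_of u v :
  prefix_of u = prefix_of v <-> (forall i, 0 < i < n -> letter u i = letter v i).
Proof.
split=> [e i hi|e]; last first.
  by apply: eq_from_tnth => i; rewrite !tnth_mktuple e //; have := ltn_ord i; lia.
have hi' : i.-1 < n.-1 by lia.
have := congr1 (fun p => tnth p (Ordinal hi')) e.
by rewrite !tnth_mktuple /= prednK //; lia.
Qed.

(* Words that differ only in the last letter have the same in-neighbours, so
   only these words themselves can tell them apart. *)
Lemma identifying_code_prefix (C : {set n.-tuple V}) :
  identifying_code (@deBruijn d n) t C -> {in ~: C &, injective prefix_of}.
Proof.
move=> [_ sep] u v; rewrite !inE => uC vC /eq_prefix_of uv.
have sub u' v' : u' \notin C -> (forall i, 0 < i < n -> letter u' i = letter v' i) ->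
    ID (@deBruijn d n) t C u' \subset ID (@deBruijn d n) t C v'.
  move=> u'C e; apply/subsetP => x; rewrite !in_setI => /andP[xu xC].
  rewrite xC andbT; case/in_ballP: xu => -[|k] kt xu.
    case/negP: u'C; have <- // : x = u'.
    by apply: eq_letterP => i hi; have := xu i; rewrite addn0; apply; lia.
  by apply/in_ballP; exists k.+1 => // i i0 ik; rewrite xu ?e //; lia.
apply/eqP; apply: contraT => /eqP/sep[].
by apply/eqP; rewrite eqEsubset !sub // => i hi; rewrite uv.
Qed.

End Code.

Lemma card_identifying_code_setC (d t n : nat) (C : {set n.-tuple 'Z_d}) :
    2 <= d -> 2 <= t -> 2 * t <= n -> identifying_code (@deBruijn d n) t C ->
  #|~: C| <= d ^ n.-1.
Proof.
move=> hd ht hnt /(identifying_code_prefix ht hnt)/card_in_imset <-.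
by rewrite (leq_trans (max_card _)) // card_tuple card_ord Zp_cast.
Qed.

(** Each prefix has exactly one extension outside the code: at most one because the code is
    identifying, at least one by solving the codeword equation for the last letter. *)
Lemma card_code_setC (d t n : nat) :
  2 <= d -> 2 <= t -> 5 <= n -> 2 * t <= n -> #|~: code d n t| = d ^ n.-1.
Proof.
move=> hd ht hn hnt.
have inj := identifying_code_prefix ht hnt (identifying_code_code d ht hnt hn).
rewrite -(card_in_imset inj).
rewrite -[RHS](_ : #|{: n.-1.-tuple 'Z_d}| = _); last first.
  by rewrite card_tuple card_ord Zp_cast.
apply: eq_card => p; rewrite !inE; apply/imsetP.
pose g i : 'Z_d := nth 0%R p i.-1.
pose x := string_of n (fun i => if i == n then (g t + offset n t g)%R else g i).
have xg i : 0 < i < n -> letter x i = g i.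
  by move=> hi; rewrite letter_string_of; [case: eqP => //; lia|lia].
exists x.
  rewrite in_setC (@in_code_off _ _ _ ht hnt _ g); last by move=> i hi _; exact: xg.
  rewrite letter_string_of ?eqxx ?xg; try lia.
  by rewrite addrC addKr eqxx.
by apply: eq_from_tnth => i; rewrite tnth_mktuple xg /g ?(tnth_nth 0%R) //;
  have := ltn_ord i; lia.
Qed.

Theorem theorem3p9 (d t n : nat) (hd : 2 <= d) (ht : 2 <= t) (hn : 5 <= n)
    (hnt : 2 * t <= n) :
  [/\ identifying_code (@deBruijn d n) t (code d n t),
      #|code d n t| = d ^ (n - 1) * (d - 1)
    & forall C : {set n.-tuple 'Z_d},
        identifying_code (@deBruijn d n) t C -> #|code d n t| <= #|C|].
Proof.
have cC (C : {set n.-tuple 'Z_d}) : #|C| + #|~: C| = d ^ n.-1 * d.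
  by rewrite cardsC card_tuple card_ord Zp_cast // -expnSr prednK //; lia.
have cS := card_code_setC hd ht hn hnt.
split; first exact: identifying_code_code.
  have := cC (code d n t); rewrite cS mulnBr muln1 subn1; lia.
(* The complement of [C] is at most as large as that of the code. *)
move=> C /card_identifying_code_setC - /(_ hd ht hnt).
by have := cC C; have := cC (code d n t); rewrite cS; lia.
Qed.
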